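(* Let $\mathcal{L}$ be an algebraic signature with at least one constant symbol and let $\mathcal{V}$ be a variety of $\mathcal{L}$-algebras. Then $\mathcal{V}$ is coherent if and only if any (equivalently, each) of the following equivalent conditions holds: (1) For any finite disjoint sets of variables $\overline{x},\overline{y}$ and any finite set $\Sigma$ of equations with variables in $\overline{x},\overline{y}$, there exists a finite set $\Pi$ of equations with variables in $\overline{y}$ such that for every equation $\varepsilon$ with variables in $\overline{y}$, $\Sigma\models_{\mathcal{V}}\varepsilon \iff \Pi\models_{\mathcal{V}}\varepsilon$. (2) For any finite disjoint sets $\overline{x},\overline{y}$ and any compact congruence $\Theta$ on $\mathbf{F}(\overline{x},\overline{y})$, the congruence $\Theta\cap F(\overline{y})^2$ on $\mathbf{F}(\overline{y})$ is compact. (3) For any finite disjoint sets $\overline{x},\overline{y}$, the compact lifting of the inclusion map $\mathbf{F}(\overline{y})\to\mathbf{F}(\overline{x},\overline{y})$ has a right adjoint. (4) The compact lifting of any homomorphism between finitely presented algebras in $\mathcal{V}$ has a right adjoint.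
   Context: $\mathbf{F}(\overline{x})$ is the free algebra of $\mathcal{V}$ over the set $\overline{x}$, with universe $F(\overline{x})$; $\overline{x},\overline{y}$ denotes the union of disjoint sets $\overline{x}$ and $\overline{y}$, and $\mathbf{F}(\overline{y})$ is regarded as a subalgebra of $\mathbf{F}(\overline{x},\overline{y})$. For a set of equations $\Sigma\cup\{\varepsilon\}$, $\Sigma\models_{\mathcal{V}}\varepsilon$ means: for every $\mathbf{A}\in\mathcal{V}$ and every homomorphism $e$ from the term algebra (over the variables involved) to $\mathbf{A}$, if $e$ satisfies all equations in $\Sigma$ (i.e. $\Sigma\subseteq\ker e$), then $e$ satisfies $\varepsilon$. A congruence is compact if it is finitely generated; $\mathrm{KCon}\,\mathbf{A}$ is the poset (join-semilattice) of compact congruences of $\mathbf{A}$ ordered by inclusion. For a homomorphism $h\colon\mathbf{A}\to\mathbf{B}$, the compact lifting of $h$ is the map $\mathrm{KCon}\,\mathbf{A}\to\mathrm{KCon}\,\mathbf{B}$ sending $\psi$ to the congruence of $\mathbf{B}$ generated by $\{\langle h(a),h(a')\rangle\mid\langle a,a'\rangle\in\psi\}$. A right adjoint of an order-preserving map $u\colon P\to Q$ is an order-preserving map $v\colon Q\to P$ with $u(p)\le q\iff p\le v(q)$. An algebra in $\mathcal{V}$ is finitely presented if it is isomorphic to $\mathbf{F}(\overline{x})/\Theta$ for some finite $\overline{x}$ and compact $\Theta$. $\mathcal{V}$ is coherent if every finitely generated subalgebra of a finitely presented member of $\mathcal{V}$ is finitely presented. *)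

(* Defs.v *)
From HB Require Import structures.
From mathcomp Require Import all_boot.
From mathcomp Require Import boolp classical_sets functions cardinality.

Set Implicit Arguments.
Unset Strict Implicit.
Unset Printing Implicit Defensive.

Local Open Scope classical_set_scope.
Local Open Scope quotient_scope.

Record signature := Signature { op :> Type; arity : op -> nat }.

Record algebra (S : signature) := Algebra {
  carrier :> Type;
  interp : forall f : S, ('I_(arity f) -> carrier) -> carrier }.

Arguments interp {S A} f a : rename.

Record hom (S : signature) (A B : algebra S) := Hom {
  hom_fun :> A -> B;
  hom_interp : forall (f : S) (a : 'I_(arity f) -> A),
    hom_fun (interp f a) = interp f (fun i => hom_fun (a i)) }.

Lemma hom_comp_interp (S : signature) (A B C : algebra S) (h : hom B C)
    (k : hom A B) (f : S) (a : 'I_(arity f) -> A) :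
  h (k (interp f a)) = interp f (fun i => h (k (a i))).
Proof. by rewrite !hom_interp. Qed.

Definition hom_comp (S : signature) (A B C : algebra S) (h : hom B C)
    (k : hom A B) : hom A C :=
  @Hom S A C (fun a => h (k a)) (hom_comp_interp h k).

Definition isomorphic (S : signature) (A B : algebra S) : Prop :=
  exists h : hom A B, bijective h.

Record subuniverse (S : signature) (A : algebra S) := Subuniverse {
  subuniv_set :> A -> Prop;
  subuniv_interp : forall (f : S) (a : 'I_(arity f) -> A),
    (forall i, subuniv_set (a i)) -> subuniv_set (interp f a) }.

Definition subalgebra (S : signature) (A : algebra S) (U : subuniverse A) :
    algebra S :=
  @Algebra S {x : A | U x} (fun f a =>
    exist _ (interp f (fun i => sval (a i)))
      (subuniv_interp (fun i => svalP (a i)))).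

Definition finitely_generated (S : signature) (A : algebra S)
    (U : subuniverse A) : Prop :=
  exists2 G : set A, finite_set G &
    forall x, U x <-> forall W : subuniverse A, (forall g, G g -> W g) -> W x.

Definition product (S : signature) (I : Type) (A : I -> algebra S) :
    algebra S :=
  @Algebra S (forall i, A i) (fun f a i => interp f (fun k => a k i)).

(* A variety is a class closed under homomorphic images, subalgebras and
   products; the empty index type makes it nonempty. *)
Record variety (S : signature) (V : algebra S -> Prop) : Prop := Variety {
  variety_image : forall (A B : algebra S) (h : hom A B),
    V A -> (forall b : B, exists a : A, h a = b) -> V B;
  variety_sub : forall (A : algebra S) (U : subuniverse A),
    V A -> V (subalgebra U);
  variety_product : forall (I : Type) (A : I -> algebra S),
    (forall i, V (A i)) -> V (product A) }.

Record congruence (S : signature) (A : algebra S) := Congruence {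
  cong_rel :> A -> A -> Prop;
  cong_equiv : RelationClasses.Equivalence cong_rel;
  cong_interp : forall (f : S) (a b : 'I_(arity f) -> A),
    (forall i, cong_rel (a i) (b i)) -> cong_rel (interp f a) (interp f b) }.

Definition cong_le (S : signature) (A : algebra S) (t1 t2 : congruence A) :
    Prop :=
  forall a b, t1 a b -> t2 a b.

Lemma generated_equiv (S : signature) (A : algebra S) (R : set (A * A)) :
  RelationClasses.Equivalence (fun a b => forall t : congruence A,
    (forall p, R p -> t p.1 p.2) -> t a b).
Proof.
split=> [a t _|a b ab t Rt|a b c ab bc t Rt]; have [r s tr] := cong_equiv t.
- exact: r.
- by apply: s; apply: ab.
- by apply: tr (ab t Rt) (bc t Rt).
Qed.

Lemma generated_interp (S : signature) (A : algebra S) (R : set (A * A))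
    (f : S) (a b : 'I_(arity f) -> A) :
  (forall i, forall t : congruence A,
    (forall p, R p -> t p.1 p.2) -> t (a i) (b i)) ->
  forall t : congruence A,
    (forall p, R p -> t p.1 p.2) -> t (interp f a) (interp f b).
Proof. by move=> ab t Rt; apply: cong_interp => i; apply: ab. Qed.

Definition generated (S : signature) (A : algebra S) (R : set (A * A)) :
    congruence A :=
  Congruence (generated_equiv R) (@generated_interp S A R).

Definition compact (S : signature) (A : algebra S) (t : congruence A) : Prop :=
  exists2 R : set (A * A), finite_set R &
    forall a b, t a b <-> generated R a b.

Definition KCon (S : signature) (A : algebra S) : Type :=
  {t : congruence A | compact t}.

Definition KCon_le (S : signature) (A : algebra S) (t1 t2 : KCon A) : Prop :=
  cong_le (sval t1) (sval t2).

Lemma preimage_equiv (S : signature) (A B : algebra S) (h : hom A B)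
    (t : congruence B) :
  RelationClasses.Equivalence (fun a a' => t (h a) (h a')).
Proof.
have [r s tr] := cong_equiv t.
by split=> [a|a b|a b c]; [exact: r|exact: s|exact: tr].
Qed.

Lemma preimage_interp (S : signature) (A B : algebra S) (h : hom A B)
    (t : congruence B) (f : S) (a b : 'I_(arity f) -> A) :
  (forall i, t (h (a i)) (h (b i))) -> t (h (interp f a)) (h (interp f b)).
Proof. by move=> ab; rewrite !hom_interp; apply: cong_interp. Qed.

Definition cong_preimage (S : signature) (A B : algebra S) (h : hom A B)
    (t : congruence B) : congruence A :=
  Congruence (preimage_equiv h t) (@preimage_interp S A B h t).

Definition cong_image (S : signature) (A B : algebra S) (h : hom A B)
    (t : congruence A) : congruence B :=
  generated [set q | exists a a', t a a' /\ q = (h a, h a')].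

Lemma cong_image_compact (S : signature) (A B : algebra S) (h : hom A B)
    (t : congruence A) : compact t -> compact (cong_image h t).
Proof.
case=> R finR tR; exists ((fun p => (h p.1, h p.2)) @` R).
  exact: finite_image.
move=> b b'; split=> bb' u Ru; apply: bb' => q.
- case=> a [a' [/tR aa' ->]] /=; apply: (aa' (cong_preimage h u)) => p Rp.
  by apply: (Ru (h p.1, h p.2)); exists p.
- case=> p Rp <-; apply: (Ru (h p.1, h p.2)).
  by exists p.1, p.2; split=> //; apply/tR => v; apply.
Qed.

Definition compact_lifting (S : signature) (A B : algebra S) (h : hom A B)
    (t : KCon A) : KCon B :=
  exist _ (cong_image h (sval t)) (cong_image_compact h (svalP t)).

Definition has_right_adjoint (P Q : Type) (leP : P -> P -> Prop)
    (leQ : Q -> Q -> Prop) (u : P -> Q) : Prop :=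
  exists2 v : Q -> P,
    forall q q', leQ q q' -> leP (v q) (v q') &
    forall p q, leQ (u p) q <-> leP p (v q).

Section Quotient.
Variables (S : signature) (A : algebra S) (t : congruence A).

Definition quotient_rel (a b : {classic A}) : bool := `[< t a b >].

Lemma quotient_rel_refl : reflexive quotient_rel.
Proof. by move=> a; apply/asboolP; have [r _ _] := cong_equiv t; apply: r. Qed.

Lemma quotient_rel_sym : symmetric quotient_rel.
Proof.
by move=> a b; have [_ s _] := cong_equiv t; apply/asboolP/asboolP; apply: s.
Qed.

Lemma quotient_rel_trans : transitive quotient_rel.
Proof.
move=> b a c /asboolP ab /asboolP bc; apply/asboolP.
by have [_ _ tr] := cong_equiv t; apply: tr ab bc.
Qed.

Definition quotient_equiv : equiv_rel {classic A} :=
  EquivRel quotient_rel quotient_rel_refl quotient_rel_sym quotient_rel_trans.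

Definition quotient : algebra S :=
  @Algebra S {eq_quot quotient_equiv} (fun f a =>
    \pi_({eq_quot quotient_equiv}) (interp f (fun i => repr (a i) : A))).

Definition class_of (a : A) : quotient :=
  \pi_({eq_quot quotient_equiv}) (a : {classic A}).

Definition rep (q : quotient) : A := repr (q : {eq_quot quotient_equiv}).

Lemma class_of_rep q : class_of (rep q) = q.
Proof. exact: reprK. Qed.

Lemma class_ofP a b : class_of a = class_of b <-> t a b.
Proof. by split=> [/eqmodP/asboolP//|ab]; apply/eqmodP/asboolP. Qed.

Lemma rep_class_of a : t (rep (class_of a)) a.
Proof. by apply/class_ofP; rewrite class_of_rep. Qed.

End Quotient.

Inductive term (S : signature) (X : Type) : Type :=
  | Var of X
  | App (f : S) of ('I_(arity f) -> term S X).

Definition term_algebra (S : signature) (X : Type) : algebra S :=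
  @Algebra S (term S X) (@App S X).

Fixpoint rename (S : signature) (X Y : Type) (g : X -> Y) (s : term S X) :
    term S Y :=
  match s with
  | Var x => Var S (g x)
  | App f a => App (fun i => rename g (a i))
  end.

Definition equation (S : signature) (X : Type) : Type := (term S X * term S X)%type.

Definition rename_eq (S : signature) (X Y : Type) (g : X -> Y)
    (e : equation S X) : equation S Y := (rename g e.1, rename g e.2).

Definition satisfies (S : signature) (X : Type) (A : algebra S)
    (v : hom (term_algebra S X) A) (e : equation S X) : Prop :=
  v e.1 = v e.2.

Definition entails (S : signature) (V : algebra S -> Prop) (X : Type)
    (Sigma : set (equation S X)) (e : equation S X) : Prop :=
  forall A : algebra S, V A -> forall v : hom (term_algebra S X) A,
    (forall d, Sigma d -> satisfies v d) -> satisfies v e.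

Section Free.
Variables (S : signature) (V : algebra S -> Prop).

Lemma free_equiv (X : Type) :
  RelationClasses.Equivalence
    (fun s u : term_algebra S X => entails V set0 (s, u)).
Proof.
split=> [s A VA v _//|s u su A VA v h|s u w su uw A VA v h]; rewrite /satisfies.
- by rewrite /= (su A VA v h : v s = v u).
- by rewrite /= (su A VA v h : v s = v u) (uw A VA v h : v u = v w).
Qed.

Lemma free_interp (X : Type) (f : S)
    (a b : 'I_(arity f) -> term_algebra S X) :
  (forall i, entails V set0 (a i, b i)) ->
  entails V set0 (interp f a, interp f b).
Proof.
move=> ab A VA v h; rewrite /satisfies /= !(hom_interp v); congr interp.
by apply: funext => i; apply: (ab i A VA v h).
Qed.

Definition free_cong (X : Type) : congruence (term_algebra S X) :=
  Congruence (free_equiv X) (@free_interp X).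

Definition free (X : Type) : algebra S := quotient (free_cong X).

Lemma rename_interp (X Y : Type) (g : X -> Y) (f : S)
    (a : 'I_(arity f) -> term_algebra S X) :
  rename g (interp f a) =
  interp (A := term_algebra S Y) f (fun i => rename g (a i)).
Proof. by []. Qed.

Definition rename_hom (X Y : Type) (g : X -> Y) :
    hom (term_algebra S X) (term_algebra S Y) :=
  @Hom S (term_algebra S X) (term_algebra S Y) (rename g) (rename_interp g).

Definition free_map_fun (X Y : Type) (g : X -> Y) (p : free X) : free Y :=
  class_of (free_cong Y) (rename g (rep p)).

Lemma free_rename (X Y : Type) (g : X -> Y) (s u : term S X) :
  free_cong X s u -> free_cong Y (rename g s) (rename g u).
Proof.
move=> su A VA v h; exact: (su A VA (hom_comp v (rename_hom g))).
Qed.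

Lemma free_map_interp (X Y : Type) (g : X -> Y) (f : S)
    (a : 'I_(arity f) -> free X) :
  free_map_fun g (interp f a) = interp f (fun i => free_map_fun g (a i)).
Proof.
have [_ sY trY] := cong_equiv (free_cong Y).
apply/class_ofP/(trY _ (rename g (interp f (fun i => rep (a i))))).
  exact/free_rename/rep_class_of.
apply: (@cong_interp S _ (free_cong Y) f (fun i => rename g (rep (a i)))) => i.
exact/sY/rep_class_of.
Qed.

Definition free_map (X Y : Type) (g : X -> Y) : hom (free X) (free Y) :=
  @Hom S (free X) (free Y) (free_map_fun g) (@free_map_interp X Y g).

(* The disjoint union of sets of variables X and Y is the sum type X + Y;
   free Y is viewed inside free (X + Y) along this map. *)
Definition free_incl (X Y : Type) : hom (free Y) (free (X + Y)%type) :=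
  free_map inr.

Definition finitely_presented (A : algebra S) : Prop :=
  V A /\ exists (X : finType) (t : congruence (free X)),
    compact t /\ isomorphic A (quotient t).

Definition coherent : Prop :=
  forall A : algebra S, finitely_presented A ->
  forall U : subuniverse A, finitely_generated U ->
    finitely_presented (subalgebra U).

End Free.

(* Main.v *)
(* For a homomorphism h, a right adjoint of the compact lifting of h must send
   a compact congruence Psi to its inverse image under h: test the adjunction on
   principal congruences.  Hence (3) and (4) say that inverse images of compact
   congruences are compact, and (1) is (2) written with equations.

   Coherence gives (2) because the kernel of a homomorphism from a finitely
   generated free algebra onto a finitely presented algebra is compact; apply
   this to the subalgebra generated by the images of Y in F(X + Y)/Theta.
   Conversely, given (2), a homomorphism g from F(Y) to a finitely presented
   algebra B = F(X)/Phi extends to a surjection F(X + Y) -> B with compact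
   kernel, so that inverse images of compact congruences under g are compact by
   restriction from F(X + Y) to F(Y).  Equality on B yields coherence, and the
   general case yields (4). *)
Require Import Defs.
From mathcomp Require Import all_boot.
From mathcomp Require Import boolp classical_sets functions cardinality.

Set Implicit Arguments.
Unset Strict Implicit.
Unset Printing Implicit Defensive.

Local Open Scope classical_set_scope.

Lemma inj_surj_bijective (A B : Type) (h : A -> B) :
  injective h -> (forall b, exists a, h a = b) -> bijective h.
Proof.
move=> h_inj /choice[s sK]; exists s => // a.
exact/h_inj/sK.
Qed.

(** Turns a finite set of generators into a family over ['I_n], hence into finitely many
    variables. *)
Lemma finite_set_enum (T : Type) (G : set T) :
  finite_set G -> exists n (e : 'I_n -> T), forall x, G x <-> exists i, e i = x.
Proof.
move=> /(@finite_seqP {classic T})[s Gs]; exists (size s), (tnth (in_tuple s)) => x.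
have -> : G x = (x \in (s : seq {classic T})) by rewrite Gs.
split=> [/(tnthP (in_tuple s))[i ->]|[i <-]]; first by exists i.
exact: (@mem_tnth _ {classic T} i (in_tuple s)).
Qed.

(** * Congruences and their finite generation *)

Section Congruences.
Variable S : signature.

Section OneAlgebra.
Variable A : algebra S.
Implicit Types (t : congruence A) (R : set (A * A)).

Lemma cong_refl t a : t a a.
Proof. by have [r _ _] := cong_equiv t; apply: r. Qed.

Lemma cong_sym t a b : t a b -> t b a.
Proof. by have [_ s _] := cong_equiv t; apply: s. Qed.

Lemma cong_trans t a b c : t a b -> t b c -> t a c.
Proof. by have [_ _ tr] := cong_equiv t; apply: tr. Qed.

Lemma generated_in R a b : R (a, b) -> generated R a b.
Proof. by move=> Rab t /(_ _ Rab). Qed.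

Lemma compact_of_generators t R :
    finite_set R -> (forall p, R p -> t p.1 p.2) ->
    (forall u : congruence A, (forall p, R p -> u p.1 p.2) -> cong_le t u) ->
  compact t.
Proof.
move=> finR Rt tmin; exists R => // a b.
by split=> [tab u Ru|]; [exact: tmin tab|exact].
Qed.

Lemma compact_generators t : compact t ->
  exists R, [/\ finite_set R, forall p, R p -> t p.1 p.2 &
    forall u : congruence A, (forall p, R p -> u p.1 p.2) -> cong_le t u].
Proof.
case=> R finR tR; exists R; split=> // [[a b] Rab|u Ru a b /tR tab].
  exact/tR/generated_in.
exact: tab.
Qed.

Lemma generated_compact R : finite_set R -> compact (generated R).
Proof. by move=> finR; exists R. Qed.

Lemma compact_ext t t' : (forall a b, t a b <-> t' a b) -> compact t -> compact t'.
Proof. by move=> tt' [R finR tR]; exists R => // a b; rewrite -tt'. Qed.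

Lemma eq_cong_equiv : RelationClasses.Equivalence (@eq A).
Proof. by split=> [a|a b|a b c] // -> . Qed.

Lemma eq_cong_interp (f : S) (a b : 'I_(arity f) -> A) :
  (forall i, a i = b i) -> interp f a = interp f b.
Proof. by move=> ab; congr interp; apply: funext. Qed.

Definition eq_cong : congruence A := Congruence eq_cong_equiv eq_cong_interp.

Lemma eq_cong_compact : compact eq_cong.
Proof.
apply: (@compact_of_generators _ set0) => // u _ a b /= ->.
exact: cong_refl.
Qed.

End OneAlgebra.

(** * Inverse images of congruences and right adjoints *)

Definition hom_id (A : algebra S) : hom A A :=
  @Hom S A A (fun a => a) (fun _ _ => erefl).

Definition ker (A B : algebra S) (h : hom A B) : congruence A :=
  cong_preimage h (eq_cong B).

Lemma right_adjointP (A B : algebra S) (h : hom A B) :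
  has_right_adjoint (@KCon_le S A) (@KCon_le S B) (compact_lifting h) <->
  forall t : congruence B, compact t -> compact (cong_preimage h t).
Proof.
split=> [[v _ adj] t ct|pre].
  apply: compact_ext (svalP (v (exist _ t ct))) => a b; split.
    (* Counit: the lifting of the value of [v] at [t] lies below [t]. *)
    have /adj hle : KCon_le (v (exist _ t ct)) (v (exist _ t ct)) by [].
    by move=> vab; apply: hle; apply: generated_in; exists a, b.
  move=> tab.
  (* The lifting of the principal congruence of [(a, b)] lies below [t], so the adjunction puts this
     pair in the value of [v]. *)
  have c1 : compact (generated [set (a, b)]).
    exact/generated_compact/finite_set1.
  have le1 : KCon_le (exist _ _ c1) (v (exist _ t ct)).
    apply/adj => c d; apply=> _ [a' [b' [+ ->]]] /=.
    by apply: (_ : cong_le _ (cong_preimage h t)) => x y; apply=> _ ->.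
  exact/le1/generated_in.
exists (fun q => exist _ _ (pre _ (svalP q))) => [q q' qq' a b|p q].
  exact: qq'.
split=> [le a b pab|le a b]; first by apply/le/generated_in; exists a, b.
by apply=> _ [c [d [pcd ->]]]; apply: le.
Qed.

(** Compactness descends along a surjection: the [q]-images of generators upstairs generate the
    congruence on [B]. *)
Lemma compact_preimage_eq (A B C : algebra S) (q : hom A B) (h : hom B C)
    (t : congruence C) :
    (forall b, exists a, q a = b) ->
  compact (cong_preimage (hom_comp h q) t) -> compact (cong_preimage h t).
Proof.
move=> q_surj /compact_generators[R [finR Rt tmin]].
apply: (@compact_of_generators _ _ ((fun p => (q p.1, q p.2)) @` R)).
- exact: finite_image.
- by move=> _ [p Rp <-]; apply: (Rt p Rp).
move=> u Ru b b'; have [[a <-] [a' <-]] := (q_surj b, q_surj b').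
apply: (tmin (cong_preimage q u)) => p Rp.
by apply: (Ru (q p.1, q p.2)); exists p.
Qed.

(* The image of u under h; the section s avoids an existential definition, and
   the choice of s is immaterial because u contains the kernel of h. *)
Section Transport.
Variables (A B : algebra S) (h : hom A B) (s : B -> A) (u : congruence A).
Hypotheses (sK : forall b, h (s b) = b) (ker_u : cong_le (ker h) u).

Lemma transport_equiv : RelationClasses.Equivalence (fun b b' => u (s b) (s b')).
Proof.
split=> [b|b b'|b b' b'']; [exact: cong_refl|exact: cong_sym|exact: cong_trans].
Qed.

Lemma transport_interp (f : S) (a b : 'I_(arity f) -> B) :
  (forall i, u (s (a i)) (s (b i))) -> u (s (interp f a)) (s (interp f b)).
Proof.
have sf c : u (s (interp f c)) (interp f (fun i => s (c i))).
  apply: ker_u; rewrite /= sK hom_interp; congr interp.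
  by apply: funext => i; rewrite sK.
move=> ab; apply: cong_trans (sf a) _.
by apply: cong_trans (cong_sym (sf b)); apply: cong_interp.
Qed.

Definition transport : congruence B := Congruence transport_equiv transport_interp.

End Transport.

(** Generators are those of the kernel and lifts of those of [t] along a section. A congruence [u]
    containing them contains the kernel, so it descends to [B], where it contains [t]. *)
Lemma compact_preimage_surj (A B : algebra S) (h : hom A B) (t : congruence B) :
    (forall b, exists a, h a = b) -> compact (ker h) -> compact t ->
  compact (cong_preimage h t).
Proof.
move=> /choice[s sK] /compact_generators[K [finK Kh Kmin]].
move=> /compact_generators[R [finR Rt Rmin]].
apply: (@compact_of_generators _ _ (K `|` (fun p => (s p.1, s p.2)) @` R)).
- by rewrite finite_setU; split=> //; apply: finite_image.
- move=> p [/Kh/= ->|[r /Rt tr <-]]; first exact: cong_refl.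
  by rewrite /= !sK.
move=> u KRu a b tab.
have ker_u : cong_le (ker h) u by apply: Kmin => p Kp; apply: KRu; left.
have hs x : u x (s (h x)) by apply: ker_u; rewrite /= sK.
apply: cong_trans (hs a) _; apply: cong_trans (cong_sym (hs b)).
apply: (Rmin (transport sK ker_u)) tab => p Rp.
by apply: (KRu (s p.1, s p.2)); right; exists p.
Qed.

(** * Quotients, ranges and subuniverses *)

Lemma class_of_interp (A : algebra S) (t : congruence A) (f : S)
    (a : 'I_(arity f) -> A) :
  class_of t (interp f a) = interp f (fun i => class_of t (a i)).
Proof.
apply/class_ofP/cong_interp => i.
exact/cong_sym/rep_class_of.
Qed.

Definition class_hom (A : algebra S) (t : congruence A) : hom A (quotient t) :=
  Hom (@class_of_interp A t).

Lemma class_hom_surj (A : algebra S) (t : congruence A) (q : quotient t) :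
  exists a, class_hom t a = q.
Proof. by exists (rep q); apply: class_of_rep. Qed.

Section Lift.
Variables (A B : algebra S) (t : congruence A) (h : hom A B).
Hypothesis t_ker : cong_le t (ker h).

Lemma quotient_lift_interp (f : S) (a : 'I_(arity f) -> quotient t) :
  h (rep (interp f a)) = interp f (fun i => h (rep (a i))).
Proof. by rewrite -hom_interp; apply/t_ker/rep_class_of. Qed.

Definition quotient_lift : hom (quotient t) B :=
  @Hom S (quotient t) B (fun q => h (rep q)) quotient_lift_interp.

Lemma quotient_lift_class a : quotient_lift (class_hom t a) = h a.
Proof. exact/t_ker/rep_class_of. Qed.

End Lift.

(** First isomorphism theorem; the map out of [B] is built from a section of [h]. *)
Lemma isomorphic_quotient_ker (A B : algebra S) (h : hom A B) :
  (forall b, exists a, h a = b) -> isomorphic B (quotient (ker h)).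
Proof.
move=> /choice[s sK].
have gE (f : S) (b : 'I_(arity f) -> B) :
    class_of (ker h) (s (interp f b)) =
    interp f (fun i => class_of (ker h) (s (b i))).
  rewrite -class_of_interp; apply/class_ofP; rewrite /= sK hom_interp.
  by congr interp; apply: funext => i; rewrite sK.
exists (@Hom S B (quotient (ker h)) (fun b => class_of (ker h) (s b)) gE).
apply: inj_surj_bijective => [b b' /class_ofP|q].
  by rewrite /= !sK.
by exists (h (rep q)); rewrite -[RHS]class_of_rep; apply/class_ofP; rewrite /= sK.
Qed.

Section Range.
Variables (A B : algebra S) (h : hom A B).

Lemma range_interp (f : S) (b : 'I_(arity f) -> B) :
  (forall i, exists a, h a = b i) -> exists a, h a = interp f b.
Proof.
move=> /choice[s sK]; exists (interp f s).
by rewrite hom_interp; congr interp; apply: funext.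
Qed.

Definition range_subuniverse : subuniverse B :=
  @Subuniverse S B (fun b => exists a, h a = b) range_interp.

Lemma corestrict_interp (U : subuniverse B) (Uh : forall a, U (h a)) (f : S)
    (a : 'I_(arity f) -> A) :
  exist U (h (interp f a)) (Uh _) =
  interp (A := subalgebra U) f (fun i => exist U (h (a i)) (Uh _)).
Proof. by apply: eq_exist; rewrite /= hom_interp. Qed.

Definition corestrict (U : subuniverse B) (Uh : forall a, U (h a)) :
    hom A (subalgebra U) :=
  @Hom S A (subalgebra U) (fun a => exist U (h a) (Uh a)) (corestrict_interp Uh).

End Range.

Lemma hom_preimage_interp (A B : algebra S) (h : hom A B) (U : subuniverse B)
    (f : S) (a : 'I_(arity f) -> A) :
  (forall i, U (h (a i))) -> U (h (interp f a)).
Proof. by move=> Ua; rewrite hom_interp; apply: subuniv_interp. Qed.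

Definition subuniverse_preimage (A B : algebra S) (h : hom A B)
    (U : subuniverse B) : subuniverse A :=
  @Subuniverse S A (fun a => U (h a)) (@hom_preimage_interp A B h U).

Lemma agree_interp (A B : algebra S) (t : congruence B) (h k : hom A B) (f : S)
    (a : 'I_(arity f) -> A) :
  (forall i, t (h (a i)) (k (a i))) -> t (h (interp f a)) (k (interp f a)).
Proof. by move=> hk; rewrite !hom_interp; apply: cong_interp. Qed.

(** The equalizer of [h] and [k] modulo [t]. With [free_ind], it extends agreement on generators to
    the whole free algebra. *)
Definition agree (A B : algebra S) (t : congruence B) (h k : hom A B) :
    subuniverse A :=
  @Subuniverse S A (fun a => t (h a) (k a)) (@agree_interp A B t h k).

End Congruences.

(** * Free algebras of a variety and their universal property *)

Section Free.
Variable S : signature.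

Section Eval.
Variables (X : Type) (A : algebra S) (v : X -> A).

Fixpoint eval (s : term S X) : A :=
  match s with
  | Var x => v x
  | App f a => interp f (fun i => eval (a i))
  end.

Lemma eval_interp (f : S) (a : 'I_(arity f) -> term_algebra S X) :
  eval (interp f a) = interp f (fun i => eval (a i)).
Proof. by []. Qed.

Definition eval_hom : hom (term_algebra S X) A := Hom eval_interp.

End Eval.

Variables (V : algebra S -> Prop) (hV : variety V).

(** The quotient is a homomorphic image of the range of [h], a subalgebra of [B]. Here [A] may lie
    outside [V], as a term algebra can. *)
Lemma variety_quotient_ker (A B : algebra S) (h : hom A B) (t : congruence A) :
  V B -> cong_le (ker h) t -> V (quotient t).
Proof.
move=> VB ker_t.
have /choice[s sK] : forall b : subalgebra (range_subuniverse h),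
  exists a, h a = sval b by case.
have gE (f : S) (b : 'I_(arity f) -> subalgebra (range_subuniverse h)) :
    class_of t (s (interp f b)) = interp f (fun i => class_of t (s (b i))).
  rewrite -class_of_interp; apply/class_ofP/ker_t; rewrite /= sK hom_interp.
  by congr interp; apply: funext => i; rewrite sK.
pose g := @Hom S _ (quotient t) (fun b => class_of t (s b)) gE.
apply: (variety_image hV (h := g)); first exact: variety_sub.
move=> q; have Ur : range_subuniverse h (h (rep q)) by exists (rep q).
exists (exist _ _ Ur); rewrite -[RHS]class_of_rep.
by apply/class_ofP/ker_t; rewrite /= sK.
Qed.

Lemma variety_quotient (A : algebra S) (t : congruence A) : V A -> V (quotient t).
Proof.
move=> VA; apply: (variety_quotient_ker (h := hom_id A)) => // a b /= ->.
exact: cong_refl.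
Qed.

(* The kernel of the map from the term algebra into the product of all its
   quotients in V is the free congruence. *)
Lemma variety_free (X : Type) : V (free V X).
Proof.
pose T := term_algebra S X.
pose I := {t : congruence T | V (quotient t)}.
pose P := product (fun i : I => quotient (sval i)).
have hE (f : S) (a : 'I_(arity f) -> T) :
    (fun i : I => class_of (sval i) (interp f a)) =
    interp (A := P) f (fun k i => class_of (sval i) (a k)).
  by apply: functional_extensionality_dep => i; apply: class_of_interp.
pose h : hom T P := @Hom S T P (fun s i => class_of (sval i) s) hE.
apply: (variety_quotient_ker (h := h)).
  by apply: variety_product => // -[].
move=> s u hsu A VA v _.
have Vk : V (quotient (ker v)) by apply: (variety_quotient_ker (h := v)).
by have /class_ofP := f_equal (fun p => p (exist _ _ Vk)) hsu.
Qed.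

Definition gen (X : Type) (x : X) : free V X := class_of (free_cong V X) (Var S x).

Definition term_hom (X : Type) : hom (term_algebra S X) (free V X) :=
  class_hom (free_cong V X).

Lemma free_ind (X : Type) (U : subuniverse (free V X)) :
  (forall x, U (gen x)) -> forall a, U a.
Proof.
move=> Ux a; have [s <-] := class_hom_surj a.
elim: s => [x|f s IHs]; first exact: Ux.
rewrite [App s](_ : _ = interp (A := term_algebra S X) f s) // hom_interp.
exact: subuniv_interp.
Qed.

Lemma free_factor (X : Type) (A : algebra S) (v : hom (term_algebra S X) A) :
  V A -> exists k : hom (free V X) A, forall s, k (term_hom X s) = v s.
Proof.
move=> VA.
have le : cong_le (free_cong V X) (ker v).
  by move=> s u su; apply: (su A VA v).
by exists (quotient_lift le); apply: quotient_lift_class.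
Qed.

Lemma free_extend (X : Type) (A : algebra S) (v : X -> A) :
  V A -> exists k : hom (free V X) A, forall x, k (gen x) = v x.
Proof.
move=> VA; have [k kE] := free_factor (eval_hom v) VA.
by exists k => x; apply: (kE (Var S x)).
Qed.

Lemma free_map_term (X Y : Type) (g : X -> Y) (s : term S X) :
  free_map V g (term_hom X s) = term_hom Y (rename g s).
Proof. exact/class_ofP/free_rename/rep_class_of. Qed.

Lemma free_map_gen (X Y : Type) (g : X -> Y) (x : X) :
  free_map V g (gen x) = gen (g x).
Proof. exact: (free_map_term g (Var S x)). Qed.

(** * Entailment as membership in a generated congruence *)

Definition term_pairs (X : Type) (Sigma : set (equation S X)) :
    set (free V X * free V X) :=
  (fun e => (term_hom X e.1, term_hom X e.2)) @` Sigma.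

(** The quotient of the free algebra by the pairs of [Sigma] is a generic model in [V]. Conversely,
    a valuation satisfying [Sigma] factors through the free algebra with those pairs in its
    kernel. *)
Lemma entailsP (X : Type) (Sigma : set (equation S X)) (s u : term S X) :
  entails V Sigma (s, u) <->
  generated (term_pairs Sigma) (term_hom X s) (term_hom X u).
Proof.
split=> [ent|gsu A VA v vSigma].
  apply/class_ofP.
  apply: (ent _ (variety_quotient _ (variety_free X))
    (hom_comp (class_hom (generated (term_pairs Sigma))) (term_hom X))) => d Sd.
  by apply/class_ofP/generated_in; exists d.
have [k kE] := free_factor v VA; rewrite /satisfies /= -!kE.
by apply: (gsu (ker k)) => _ [d Sd <-] /=; rewrite !kE; apply: vSigma.
Qed.

Definition compact_restriction : Prop :=
  forall (X Y : finType) (Theta : congruence (free V (X + Y)%type)),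
    compact Theta -> compact (cong_preimage (free_incl V X Y) Theta).

Definition rep_pairs (X : Type) (R : set (free V X * free V X)) :
    set (equation S X) :=
  (fun p => (rep p.1, rep p.2)) @` R.

Lemma rep_pairsK (X : Type) (R : set (free V X * free V X)) :
  term_pairs (rep_pairs R) = R.
Proof.
apply/seteqP; split=> [_ [_ [p Rp <-] <-]|p Rp] /=.
  by rewrite !class_of_rep -surjective_pairing.
exists (rep p.1, rep p.2); first by exists p.
by rewrite /= !class_of_rep -surjective_pairing.
Qed.

(** By [entailsP], finite sets of equations correspond to compact congruences; renaming along [inr]
    corresponds to [free_incl]. *)
Lemma compact_restrictionP :
  (forall (X Y : finType) (Sigma : set (equation S (X + Y)%type)),
     finite_set Sigma ->
     exists Pi : set (equation S Y), finite_set Pi /\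
       forall e : equation S Y,
         entails V Sigma (rename_eq inr e) <-> entails V Pi e) <->
  compact_restriction.
Proof.
split=> [elim X Y Theta [R finR ThetaR]|restr X Y Sigma finSigma].
  have [|Pi [finPi PiE]] := elim X Y (rep_pairs R); first exact: finite_image.
  exists (term_pairs Pi); first exact: finite_image.
  move=> a b; have [[s <-] [u <-]] := (class_hom_surj a, class_hom_surj b).
  rewrite -entailsP -PiE entailsP rep_pairsK -ThetaR /=.
  by have /= -> := free_map_term inr s; have /= -> := free_map_term inr u.
have [|R finR RE] := restr X Y (generated (term_pairs Sigma)).
  exact/generated_compact/finite_image.
exists (rep_pairs R); split=> [|[s u]]; first exact: finite_image.
rewrite !entailsP rep_pairsK -RE /=.
by have /= -> := free_map_term inr s; have /= -> := free_map_term inr u.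
Qed.

(** * Finite presentations as surjections with compact kernel *)

Definition presentable (A : algebra S) : Prop :=
  exists (Z : finType) (k : hom (free V Z) A),
    (forall a, exists z, k z = a) /\ compact (ker k).

Lemma finitely_presentedP (A : algebra S) :
  finitely_presented V A <-> V A /\ presentable A.
Proof.
split=> [[VA [Z [t [ct [h [g hK gK]]]]]]|[VA [Z [k [k_surj ck]]]]]; split=> //.
  have gE (f : S) (a : 'I_(arity f) -> quotient t) :
      g (interp f a) = interp f (fun i => g (a i)).
    apply: (can_inj hK); rewrite gK hom_interp; congr interp.
    by apply: funext => i; rewrite gK.
  exists Z, (hom_comp (@Hom S (quotient t) A g gE) (class_hom t)); split.
    by move=> a; have [z zE] := class_hom_surj (h a); exists z; rewrite -[RHS]hK -zE.
  apply: compact_ext ct => a b; split=> [/class_ofP/= -> //|/(can_inj gK)].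
  by move=> /class_ofP.
by exists Z, (ker k); split=> //; apply: isomorphic_quotient_ker.
Qed.

Lemma free_finitely_presented (X : finType) : finitely_presented V (free V X).
Proof.
apply/finitely_presentedP; split; first exact: variety_free.
exists X, (hom_id _); split; first by move=> a; exists a.
exact: eq_cong_compact.
Qed.

(* With sigma and rho the liftings of g and k through each other, the kernel of
   g is generated by the images under rho of the relations of k, together with
   the pairs (y, rho (sigma y)). *)
Lemma compact_ker (A : algebra S) (Y : finType) (g : hom (free V Y) A) :
  presentable A -> (forall a, exists b, g b = a) -> compact (ker g).
Proof.
move=> [Z [k [k_surj /compact_generators[R [finR Rk Rmin]]]]] g_surj.
have /choice[s0 s0E] y := k_surj (g (gen y)).
have /choice[r0 r0E] z := g_surj (k (gen z)).
have [sigma sigmaE] := free_extend s0 (variety_free Z).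
have [rho rhoE] := free_extend r0 (variety_free Y).
have ks : forall a, k (sigma a) = g a.
  apply: (free_ind (U := agree (eq_cong A) (hom_comp k sigma) g)) => y /=.
  by rewrite sigmaE s0E.
have gr : forall a, g (rho a) = k a.
  apply: (free_ind (U := agree (eq_cong A) (hom_comp g rho) k)) => z /=.
  by rewrite rhoE r0E.
apply: (@compact_of_generators _ _ _ ((fun p => (rho p.1, rho p.2)) @` R `|`
    range (fun y => (gen y, rho (sigma (gen y)))))).
- rewrite finite_setU; split; first exact: finite_image.
  exact/finite_image/finite_finset.
- by move=> _ [[p /Rk/= pk <-]|[y _ <-]] /=; rewrite gr ?gr ?ks.
move=> u Ru.
have id_u : forall a, u a (rho (sigma a)).
  apply: (free_ind (U := agree u (hom_id _) (hom_comp rho sigma))) => y /=.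
  by apply: (Ru (gen y, rho (sigma (gen y)))); right; exists y.
move=> a b /= gab; apply: cong_trans (id_u a) _.
apply: cong_trans (cong_sym (id_u b)).
apply: (Rmin (cong_preimage rho u)) => [p Rp|]; last by rewrite /= !ks.
by apply: (Ru (rho p.1, rho p.2)); left; exists p.
Qed.

(** As [g] may fail to be onto, variables [X] for generators of [B] are adjoined. The resulting [pi]
    is onto, so it pulls [t] back to a compact congruence, which is then restricted to [Y]. *)
Lemma compact_preimage_free (B : algebra S) (Y : finType) (g : hom (free V Y) B)
    (t : congruence B) :
  compact_restriction -> finitely_presented V B -> compact t ->
  compact (cong_preimage g t).
Proof.
move=> restr /finitely_presentedP[VB presB] ct.
have [X [p [p_surj _]]] := presB.
pose v (z : X + Y) := match z with inl x => p (gen x) | inr y => g (gen y) end.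
have [pi piE] := free_extend v VB.
have pi_inl : forall a, pi (free_map V inl a) = p a.
  apply: (free_ind (U := agree (eq_cong B) (hom_comp pi (free_map V inl)) p)) => x.
  by rewrite /= [free_map_fun _ _](free_map_gen inl) piE.
have pi_inr : forall a, pi (free_incl V X Y a) = g a.
  apply: (free_ind (U := agree (eq_cong B) (hom_comp pi (free_incl V X Y)) g)) => y.
  by rewrite /= [free_map_fun _ _](free_map_gen inr) piE.
have pi_surj b : exists a, pi a = b.
  by have [a <-] := p_surj b; exists (free_map V inl a).
have cpi := compact_preimage_surj pi_surj (compact_ker presB pi_surj) ct.
by apply: compact_ext (restr _ _ _ cpi) => a b; rewrite /= !pi_inr.
Qed.

(** Pull back further along a finite free cover of [A], then descend. *)
Lemma compact_preimage_fp (A B : algebra S) (h : hom A B) (t : congruence B) :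
  compact_restriction -> finitely_presented V A -> finitely_presented V B ->
  compact t -> compact (cong_preimage h t).
Proof.
move=> restr /finitely_presentedP[_ [Z [k [k_surj _]]]] fpB ct.
exact/(compact_preimage_eq k_surj)/compact_preimage_free.
Qed.

(** * Coherence and restriction to fewer variables *)

Lemma coherent_restriction : coherent V -> compact_restriction.
Proof.
move=> coh X Y Theta cTheta.
pose A := quotient Theta.
(* The kernel of [h] is the restriction of [Theta], and its range is generated by the images of the
   variables [Y]. *)
pose h : hom (free V Y) A := hom_comp (class_hom Theta) (free_incl V X Y).
pose U := range_subuniverse h.
have fpA : finitely_presented V A.
  split; first exact/variety_quotient/variety_free.
  by exists (X + Y)%type, Theta; split=> //; exists (hom_id _); exists id.
have fgU : finitely_generated U.
  exists (range (fun y => h (gen y))); first exact/finite_image/finite_finset.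
  move=> a; split=> [[b <-] W GW|]; last by apply=> _ [y _ <-]; exists (gen y).
  by apply: (free_ind (U := subuniverse_preimage h W)) => y; apply: GW; exists y.
have /finitely_presentedP[_ presU] := coh A fpA U fgU.
have Uh a : U (h a) by exists a.
have g_surj (b : subalgebra U) : exists a, corestrict Uh a = b.
  by case: b => b [a ab]; exists a; apply: eq_exist.
apply: compact_ext (compact_ker presU g_surj) => a b /=; split.
  by move=> /(f_equal sval)/= ?; apply/class_ofP.
by move=> /class_ofP tab; apply: eq_exist.
Qed.

Lemma restriction_coherent : compact_restriction -> coherent V.
Proof.
move=> restr A fpA U [G finG UG]; have VA : V A by case: fpA.
have [n [e eG]] := finite_set_enum finG.
have [g gE] := free_extend e VA.
have Ug : forall a, U (g a).
  apply: (free_ind (U := subuniverse_preimage g U)) => i.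
  by rewrite /= gE; apply/UG => W; apply; apply/eG; exists i.
apply/finitely_presentedP; split; first exact: variety_sub.
exists 'I_n, (corestrict Ug); split.
  case=> a Ua; have [b ba] : range_subuniverse g a.
    apply: ((UG a).1 Ua (range_subuniverse g) _) => x /eG[i <-].
    by exists (gen i).
  by exists b; apply: eq_exist.
(* The kernel of the corestriction is the inverse image under [g] of equality on [A], a compact
   congruence. *)
apply: compact_ext (compact_preimage_free g restr fpA (eq_cong_compact A)).
by move=> a b /=; split=> [ab|/(f_equal sval)//]; apply: eq_exist.
Qed.

Lemma coherentP : coherent V <-> compact_restriction.
Proof. by split; [exact: coherent_restriction|exact: restriction_coherent]. Qed.

End Free.

Theorem theorem2p3 (S : signature) (hconst : exists c : S, arity c = 0%N)
    (V : algebra S -> Prop) (hV : variety V) :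
  (coherent V <->
    (forall (X Y : finType) (Sigma : set (equation S (X + Y)%type)),
       finite_set Sigma ->
       exists Pi : set (equation S Y), finite_set Pi /\
         forall e : equation S Y,
           entails V Sigma (rename_eq inr e) <-> entails V Pi e)) /\
  (coherent V <->
    (forall (X Y : finType) (Theta : congruence (free V (X + Y)%type)),
       compact Theta -> compact (cong_preimage (free_incl V X Y) Theta))) /\
  (coherent V <->
    (forall X Y : finType,
       has_right_adjoint (@KCon_le S (free V Y))
         (@KCon_le S (free V (X + Y)%type))
         (compact_lifting (free_incl V X Y)))) /\
  (coherent V <->
    (forall A B : algebra S,
       finitely_presented V A -> finitely_presented V B ->
       forall h : hom A B,
         has_right_adjoint (@KCon_le S A) (@KCon_le S B)
           (compact_lifting h))).
Proof.
split; first by rewrite (coherentP hV) (compact_restrictionP hV).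
split; first exact: coherentP.
split; rewrite (coherentP hV).
  by split=> restr X Y; [apply/right_adjointP/restr|apply/right_adjointP].
split=> [restr A B fpA fpB h|adj X Y].
  by apply/right_adjointP => t; apply: (compact_preimage_fp hV).
(* Inclusions of finitely generated free algebras are instances of homomorphisms between finitely
   presented algebras. *)
by apply/right_adjointP/adj; apply: free_finitely_presented.
Qed.
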